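(* Consider $N$ balls of $C$ different colors, with $k_c\ge1$ balls of color $c\in\{1,\dots,C\}$, $\sum_{c}k_c=N$. Let $n$ be an integer with $1\le n<N$, and let $U_n$ and $V_n$ be the vectors of color counts in a sample of size $n$ drawn without replacement and with replacement, respectively. Then $$D\left(U_n\,\Vert\, V_n\right)\ \le\ (C-1)\left(\ln\left(\frac{N-1}{N-n}\right)+\frac{1}{N-n+1}-\frac{n}{N}\right).$$
   Context: $U_n$ has a multivariate hypergeometric distribution and $V_n$ has the multinomial distribution with $n$ trials and probabilities $p_c=k_c/N$. $D(U_n\Vert V_n)$ denotes the information divergence $D(P\Vert Q)=\sum_i p_i\ln\frac{p_i}{q_i}$ (natural logarithm, $0\ln0=0$) of the distribution $P$ of $U_n$ from the distribution $Q$ of $V_n$. *)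

(* Defs.v *)
From HB Require Import structures.
From mathcomp Require Import all_boot all_order all_algebra.
From mathcomp Require Import all_classical all_reals all_analysis.
Set Implicit Arguments.
Unset Strict Implicit.
Unset Printing Implicit Defensive.
Import Order.TTheory GRing.Theory Num.Theory.
Local Open Scope ring_scope.

(* Color-count vectors of samples of size n.  Each count is at most n, so they
   form a finite type; the vectors whose counts do not sum to n get
   probability 0 under both distributions below. *)
Definition counts (C n : nat) : finType := {ffun 'I_C -> 'I_n.+1}.

Definition hypergeometric_mass (R : realType) (C n : nat) (k : 'I_C -> nat)
    (x : counts C n) : R :=
  if (\sum_c (x c : nat) == n)%N
  then (\prod_c 'C(k c, x c))%:R / 'C(\sum_c k c, n)%:R
  else 0.

Definition multinomial_mass (R : realType) (C n : nat) (p : 'I_C -> R)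
    (x : counts C n) : R :=
  if (\sum_c (x c : nat) == n)%N
  then n`!%:R / (\prod_c (x c)`!)%:R * \prod_c p c ^+ x c
  else 0.

(* The convention 0 ln 0 = 0 is automatic, as the factor P i vanishes.  This
   real-valued sum is the information divergence only if P i = 0 whenever
   Q i = 0 (otherwise the divergence is +oo).  This holds for P hypergeometric
   and Q multinomial as above when every p c is positive, since Q then vanishes
   only where the counts do not sum to n. *)
Definition divergence (R : realType) (T : finType) (P Q : T -> R) : R :=
  \sum_i P i * ln (P i / Q i).

(* Main.v *)
Require Import Defs.
From HB Require Import structures.
From mathcomp Require Import all_boot all_order all_algebra.
From mathcomp Require Import all_classical all_reals all_analysis.
From mathcomp Require Import ring lra zify.
Set Implicit Arguments.
Unset Strict Implicit.
Unset Printing Implicit Defensive.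
Import Order.TTheory GRing.Theory Num.Theory.
Local Open Scope ring_scope.

(** Write P_k for the law of the counts of a sample drawn without replacement
    from the urn k, Q_p for the multinomial law with parameter p, K for the
    number of balls, and p_c = k_c / K.

    Single out the first ball drawn.  If its color is c, the rest of the sample
    comes from the urn k' = k - e_c, while for sampling with replacement nothing
    changes.  In terms of masses, both laws obey the same size-bias identity

      (y_c + 1) P_k(y + e_c) = (n + 1) p_c P_k'(y),
      (y_c + 1) Q_p(y + e_c) = (n + 1) p_c Q_p(y),

    with equal prefactors, so likelihood ratios are preserved and
    D(P_k || Q_p) at size n + 1 is the p-average over c of D(P_k' || Q_p) at
    size n ([divergence_first_draw]).

    Here Q_p is not the multinomial law that belongs to the urn k': that one is
    Q_p' with p' = k' / (K - 1).  As the mean of P_k' is n p' and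
    ln (Q_p' / Q_p) is linear in the counts, changing the reference law costs
    exactly n D(p' || p) ([divergence_multinomial_change]).  Hence

      D_(n+1)(k) = sum_c p_c (D_n(k - e_c) + n D(p' || p)).

    The average over c of D(p' || p) is the mutual information of two
    successive draws.  Bounding it by the chi-square divergence gives at most
    (C - 1) / (K - 1)^2 ([sum_divergence_remove_ball]).  Unrolling the
    recursion bounds the divergence by (C - 1) times the sum of
    (n - i) / (K - i)^2 over 0 < i < n.  The right-hand side of the theorem is
    (C - 1) B(K, n), where B dominates that sum because, by an elementary
    estimate of ln, n / (K - 1)^2 + B(K - 1, n) <= B(K, n + 1) for n >= 1
    ([divergence_bound_step]).

    Drawing may exhaust a color, so the induction runs over urns in which some
    k_c vanish. *)

(** * Adding a ball to a sample and removing it from the urn *)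

Definition add_ball (C n : nat) (c : 'I_C) (y : counts C n) : counts C n.+1 :=
  [ffun a => inord (y a + (a == c))].

Definition remove_ball (C : nat) (k : 'I_C -> nat) (c a : 'I_C) : nat :=
  (k a - (a == c))%N.

Lemma add_ballE (C n : nat) (c a : 'I_C) (y : counts C n) :
  add_ball c y a = (y a + (a == c))%N :> nat.
Proof.
by rewrite ffunE inordK //; have := ltn_ord (y a); case: (a == c); lia.
Qed.

Lemma sum_eq_op (C : nat) (c : 'I_C) : (\sum_a (a == c) = 1)%N.
Proof. by rewrite (bigD1 c) //= eqxx big1 // => a /negbTE ->. Qed.

Lemma sum_add_ball (C n : nat) (c : 'I_C) (y : counts C n) :
  (\sum_a add_ball c y a = (\sum_a y a).+1)%N.
Proof.
under eq_bigr do rewrite add_ballE.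
by rewrite big_split /= sum_eq_op addn1.
Qed.

Lemma sum_remove_ball (C : nat) (k : 'I_C -> nat) (c : 'I_C) :
  (0 < k c)%N -> (\sum_a remove_ball k c a = (\sum_a k a).-1)%N.
Proof.
move=> kc; rewrite (bigD1 c) //= [in RHS](bigD1 c) //= {1}/remove_ball eqxx.
rewrite subn1.
rewrite (eq_bigr k) => [|a /negbTE ac]; last by rewrite /remove_ball ac subn0.
by case: (k c) kc.
Qed.

(** The vectors with a ball of color c are exactly the y + e_c.  The
    restriction on the total is what makes the truncation by [inord] harmless
    when a ball is removed: every other count is then at most n. *)
Lemma sum_counts_gt0 (R : nmodType) (C n : nat) (c : 'I_C)
    (F : counts C n.+1 -> R) :
  \sum_(x : counts C n.+1 | (\sum_a (x a : nat) == n.+1)%N && (0 < x c)%N) F x =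
  \sum_(y : counts C n | (\sum_a (y a : nat) == n)%N) F (add_ball c y).
Proof.
pose del (x : counts C n.+1) : counts C n := [ffun a => inord (x a - (a == c))].
have delE (x : counts C n.+1) a :
    (\sum_a (x a : nat) == n.+1)%N && (0 < x c)%N ->
    del x a = (x a - (a == c))%N :> nat.
  case/andP=> /eqP sx xc; rewrite ffunE inordK //.
  have [->|ac] := eqVneq a c; first by have := ltn_ord (x c); lia.
  have : (x a + x c <= \sum_i x i)%N.
    by rewrite (bigD1 a) //= (bigD1 c) 1?eq_sym //= addnA leq_addr.
  by rewrite sx subn0; apply: leq_trans; rewrite -addn1 leq_add2l.
rewrite (reindex_onto (@add_ball C n c) del) => [|x xP].
  apply: eq_bigl => y; rewrite sum_add_ball eqSS add_ballE eqxx addn1 andbT.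
  have [sy|//] := boolP (_ == _); rewrite andTb; apply/eqP/ffunP => a.
  apply: val_inj; rewrite /= delE ?add_ballE ?addnK //.
  by rewrite sum_add_ball eqSS sy eqxx addn1.
apply/ffunP => a; apply: val_inj; rewrite /= add_ballE delE //.
by have [->|_] := eqVneq a c; rewrite ?subn0 ?addn0 // subnK //; case/andP: xP.
Qed.

(** Both binomial coefficients that change obey m C(m-1, j) = (j+1) C(m, j+1).
    The identity survives an empty color c, both sides being 0. *)
Lemma hypergeometric_mass_add_ball (R : realType) (C n : nat)
    (k : 'I_C -> nat) (c : 'I_C) (y : counts C n) :
  (y c).+1%:R * hypergeometric_mass R k (add_ball c y) =
  n.+1%:R * ((k c)%:R / (\sum_a k a)%:R)
    * hypergeometric_mass R (remove_ball k c) y.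
Proof.
rewrite /hypergeometric_mass sum_add_ball eqSS.
case: ifP => _; last by rewrite !mulr0.
have num : ((y c).+1 * \prod_a 'C(k a, add_ball c y a) =
            k c * \prod_a 'C(remove_ball k c a, y a))%N.
  rewrite (bigD1 c) //= [in RHS](bigD1 c) //= !mulnA.
  rewrite add_ballE /remove_ball eqxx addn1 subn1 -mul_bin_diag.
  congr (_ * _)%N.
  by apply: eq_bigr => a /negbTE ac; rewrite add_ballE ac addn0 subn0.
have [kc0|kc0] := posnP (k c).
  move: num; rewrite kc0 mul0n mul0r mulr0 mul0r => /eqP.
  by rewrite muln_eq0 /= => /eqP ->; rewrite mul0r mulr0.
rewrite [LHS]mulrA -natrM num sum_remove_ball //.
set K := (\sum_a k a)%N.
have K0 : (0 < K)%N by rewrite /K (bigD1 c) //= addn_gt0 kc0.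
have n0 : n.+1%:R != 0 :> R by rewrite pnatr_eq0.
have -> : 'C(K, n.+1)%:R^-1 = n.+1%:R / K%:R * 'C(K.-1, n)%:R^-1 :> R.
  rewrite -mulrA -invfM -natrM mul_bin_diag natrM invfM mulrA divff ?mul1r //.
by rewrite natrM; ring.
Qed.

(** The counterpart for draws with replacement, where the urn is unchanged;
    the common factor (n + 1) / (y_c + 1) then cancels in likelihood ratios. *)
Lemma multinomial_mass_add_ball (R : realType) (C n : nat)
    (p : 'I_C -> R) (c : 'I_C) (y : counts C n) :
  (y c).+1%:R * multinomial_mass p (add_ball c y) =
  n.+1%:R * p c * multinomial_mass p y.
Proof.
rewrite /multinomial_mass sum_add_ball eqSS.
case: ifP => _; last by rewrite !mulr0.
have -> : (\prod_a (add_ball c y a)`! = (y c).+1 * \prod_a (y a)`!)%N.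
  rewrite (bigD1 c) //= [in RHS](bigD1 c) //= mulnA add_ballE eqxx addn1 factS.
  congr (_ * _)%N; apply: eq_bigr => a /negbTE ac.
  by rewrite add_ballE ac addn0.
have -> : \prod_a p a ^+ add_ball c y a = p c * \prod_a p a ^+ y a.
  rewrite (bigD1 c) //= [in RHS](bigD1 c) //= mulrA add_ballE eqxx addn1 exprS.
  by congr (_ * _); apply: eq_bigr => a /negbTE ac; rewrite add_ballE ac addn0.
have yc : (y c).+1%:R != 0 :> R by rewrite pnatr_eq0.
have y0 : (\prod_a (y a)`!)%:R != 0 :> R.
  by rewrite pnatr_eq0 -lt0n prodn_gt0 // => a; exact: fact_gt0.
rewrite factS !natrM; field; exact/andP.
Qed.

(** Weighting by x_c discards the vectors without a ball of color c, so that
    every remaining one is some y + e_c.  With g = 1 this yields the mean, and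
    summing over c yields the decomposition by the first draw. *)
Lemma sum_hypergeometric_bias (R : realType) (C n : nat) (k : 'I_C -> nat)
    (c : 'I_C) (g : counts C n.+1 -> R) :
  \sum_(x : counts C n.+1) (x c)%:R * hypergeometric_mass R k x * g x =
  n.+1%:R * ((k c)%:R / (\sum_a k a)%:R)
    * \sum_y hypergeometric_mass R (remove_ball k c) y * g (add_ball c y).
Proof.
rewrite (bigID (fun x : counts C n.+1 =>
  (\sum_a (x a : nat) == n.+1)%N && (0 < x c)%N)) /= sum_counts_gt0 addrC big1.
  rewrite add0r mulr_sumr big_mkcond; apply: eq_bigr => y _ /=.
  case: ifP => ys; last by rewrite /hypergeometric_mass ys mul0r mulr0.
  by rewrite add_ballE eqxx addn1 hypergeometric_mass_add_ball [RHS]mulrA.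
move=> x; rewrite negb_and -leqNgt leqn0 => /orP[/negbTE xs|/eqP ->].
  by rewrite /hypergeometric_mass xs mulr0 mul0r.
by rewrite !mul0r.
Qed.

(** By exchangeability a sample x starts with color c with probability
    x_c / (n + 1), and these weights sum to 1. *)
Lemma sum_hypergeometric_first_draw (R : realType) (C n : nat)
    (k : 'I_C -> nat) (g : counts C n.+1 -> R) :
  \sum_x hypergeometric_mass R k x * g x =
  \sum_c (k c)%:R / (\sum_a k a)%:R
    * \sum_y hypergeometric_mass R (remove_ball k c) y * g (add_ball c y).
Proof.
have n0 : n.+1%:R != 0 :> R by rewrite pnatr_eq0.
apply: (mulfI n0); rewrite !mulr_sumr.
under [RHS]eq_bigr do rewrite mulrA -sum_hypergeometric_bias.
rewrite exchange_big /=; apply: eq_bigr => x _.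
under eq_bigr do rewrite -mulrA.
rewrite -mulr_suml /hypergeometric_mass.
case: ifP => [/eqP xs|_]; last by rewrite !mul0r !mulr0.
by rewrite -natr_sum xs.
Qed.

(** * Support, total mass and mean *)

Lemma sum_counts0 (R : nmodType) (C : nat) (F : counts C 0 -> R) :
  \sum_x F x = F [ffun=> ord0].
Proof.
apply: big_pred1 => x; apply/esym/eqP/ffunP => a; rewrite ffunE; exact: ord1.
Qed.

Lemma hypergeometric_mass0 (R : realType) (C : nat) (k : 'I_C -> nat) :
  hypergeometric_mass R k ([ffun=> ord0] : counts C 0) = 1.
Proof.
rewrite /hypergeometric_mass big1 => [|a _]; last by rewrite ffunE.
rewrite eqxx big1 => [|a _]; last by rewrite ffunE bin0.
by rewrite bin0 divr1.
Qed.

Lemma multinomial_mass0 (R : realType) (C : nat) (p : 'I_C -> R) :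
  multinomial_mass p ([ffun=> ord0] : counts C 0) = 1.
Proof.
rewrite /multinomial_mass big1 => [|a _]; last by rewrite ffunE.
rewrite eqxx !big1 => [|a _|a _]; rewrite ?ffunE //.
by rewrite fact0 divr1 mulr1.
Qed.

Lemma hypergeometric_mass_support (R : realType) (C n : nat)
    (k : 'I_C -> nat) (x : counts C n) :
  hypergeometric_mass R k x != 0 ->
  [/\ 0 < hypergeometric_mass R k x, (\sum_a (x a : nat) = n)%N
    & forall a, (x a <= k a)%N].
Proof.
rewrite /hypergeometric_mass; case: ifP => [/eqP xs P0|_]; last by rewrite eqxx.
split=> // [|a]; first by rewrite lt0r P0 divr_ge0 ?ler0n.
rewrite leqNgt; apply: contraNN P0 => /bin_small xa.
by rewrite (bigD1 a) //= xa mul0n mul0r.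
Qed.

Lemma sum_color_frequency (R : realType) (C : nat) (k : 'I_C -> nat) :
  (0 < \sum_a k a)%N -> \sum_c (k c)%:R / (\sum_a k a)%:R = 1 :> R.
Proof.
by move=> K0; rewrite -mulr_suml -natr_sum divff // pnatr_eq0 -lt0n.
Qed.

Lemma sum_hypergeometric_mass (R : realType) (C n : nat) (k : 'I_C -> nat) :
  (n <= \sum_a k a)%N ->
  \sum_(x : counts C n) hypergeometric_mass R k x = 1.
Proof.
elim: n k => [|n IH] k nK; first by rewrite sum_counts0 hypergeometric_mass0.
under eq_bigr do rewrite -[hypergeometric_mass _ _ _]mulr1.
rewrite (sum_hypergeometric_first_draw _ (fun=> 1)).
rewrite -[RHS](sum_color_frequency R (leq_ltn_trans (leq0n n) nK)).
apply: eq_bigr => c _.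
have [->|kc] := posnP (k c); first by rewrite !mul0r.
under [X in _ * X]eq_bigr do rewrite mulr1.
by rewrite IH ?mulr1 // sum_remove_ball //; case: (\sum_a k a)%N nK.
Qed.

Lemma hypergeometric_mean (R : realType) (C n : nat) (k : 'I_C -> nat)
    (c : 'I_C) : (n <= \sum_a k a)%N ->
  \sum_(x : counts C n) hypergeometric_mass R k x * (x c)%:R =
  n%:R * ((k c)%:R / (\sum_a k a)%:R).
Proof.
case: n => [|n] nK; first by rewrite sum_counts0 ffunE mulr0 mul0r.
under [LHS]eq_bigr do rewrite mulrC -[_ * _]mulr1.
rewrite (sum_hypergeometric_bias _ _ (fun=> 1)).
have [->|kc] := posnP (k c); first by rewrite !(mul0r, mulr0).
under [X in _ * X]eq_bigr do rewrite mulr1.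
by rewrite sum_hypergeometric_mass ?mulr1 // sum_remove_ball //;
  case: (\sum_a k a)%N nK.
Qed.

(** * Divergence and the first draw *)

(** Given that the first ball has color c, the remaining sample follows the law
    of the urn k - e_c on one side and the same multinomial law on the other.
    The first ball itself contributes nothing, as its color has the same law p
    under both schemes. *)
Lemma divergence_first_draw (R : realType) (C n : nat) (k : 'I_C -> nat) :
  let p c : R := (k c)%:R / (\sum_a k a)%:R in
  divergence (hypergeometric_mass R (n := n.+1) k) (multinomial_mass p) =
  \sum_c p c * divergence (hypergeometric_mass R (n := n) (remove_ball k c))
                          (multinomial_mass p).
Proof.
move=> p; rewrite /divergence sum_hypergeometric_first_draw.
apply: eq_bigr => c _; rewrite -/(p c).
have [->|pc0] := eqVneq (p c) 0; first by rewrite !mul0r.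
congr (_ * _); apply: eq_bigr => y _; congr (_ * ln _).
have yc0 : (y c).+1%:R != 0 :> R by rewrite pnatr_eq0.
have n0 : n.+1%:R != 0 :> R by rewrite pnatr_eq0.
rewrite -[LHS]mul1r -(divff yc0) mulf_div.
rewrite hypergeometric_mass_add_ball multinomial_mass_add_ball -/(p c).
by rewrite -mulf_div divff ?mul1r // mulf_neq0.
Qed.

(** * Changing the parameter of the multinomial reference law *)

Lemma exprn_gt0_support (R : realType) (r : R) (m : nat) :
  ((0 < m)%N -> 0 < r) -> 0 < r ^+ m.
Proof. by case: m => [|m] r0; [rewrite expr0 | exact/exprn_gt0/r0]. Qed.

Lemma ln_prod_expn (R : realType) (C n : nat) (r : 'I_C -> R)
    (y : counts C n) : (forall a, (0 < y a)%N -> 0 < r a) ->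
  ln (\prod_a r a ^+ y a) = \sum_a (y a)%:R * ln (r a).
Proof.
move=> r0; suff [] : 0 < \prod_a r a ^+ y a /\
  ln (\prod_a r a ^+ y a) = \sum_a (y a)%:R * ln (r a) by [].
elim/big_rec2: _ => [|a s m _ [m0 lnm]]; first by rewrite ln1.
have ry0 : 0 < r a ^+ y a by apply: exprn_gt0_support; exact: r0.
split; first exact: mulr_gt0.
rewrite lnM ?posrE // lnm; congr (_ + _).
have [->|ya] := posnP (y a); first by rewrite expr0 ln1 mul0r.
by rewrite lnXn ?r0 // mulr_natl.
Qed.

(** The log-likelihood ratio of two multinomial laws is
    sum_a y_a ln (q_a / p_a), whose expectation depends on P through its mean
    only. *)
Lemma divergence_multinomial_change (R : realType) (C n : nat)
    (p q : 'I_C -> R) (P : counts C n -> R) :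
  (forall y, P y != 0 -> [/\ 0 < P y, (\sum_a (y a : nat) = n)%N
    & forall a, (0 < y a)%N -> 0 < p a /\ 0 < q a]) ->
  (forall a, \sum_y P y * (y a)%:R = n%:R * q a) ->
  divergence P (multinomial_mass p) =
  divergence P (multinomial_mass q) + n%:R * divergence q p.
Proof.
move=> suppP meanP; rewrite /divergence mulr_sumr.
under [X in _ + X]eq_bigr do rewrite mulrA -meanP mulr_suml.
rewrite exchange_big -big_split /=; apply: eq_bigr => y _.
under [X in _ + X]eq_bigr do rewrite -mulrA.
rewrite -mulr_sumr -mulrDr.
have [->|/suppP[P0 ys pq]] := eqVneq (P y) 0; first by rewrite !mul0r.
have pow_gt0 (r : 'I_C -> R) : (forall a, (0 < y a)%N -> 0 < r a) ->
    0 < \prod_a r a ^+ y a.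
  by move=> r0; apply: prodr_gt0 => a _; apply: exprn_gt0_support; exact: r0.
have pp := pow_gt0 _ (fun a ya => (pq a ya).1).
have qq := pow_gt0 _ (fun a ya => (pq a ya).2).
rewrite -(ln_prod_expn (r := fun a => q a / p a)); last first.
  by move=> a /pq[p0 q0]; exact: divr_gt0.
rewrite /multinomial_mass ys eqxx.
under [\prod_a (q a / p a) ^+ _]eq_bigr do rewrite expr_div_n.
rewrite prodf_div.
have w0 : 0 < n`!%:R / (\prod_a (y a)`!)%:R :> R.
  by rewrite divr_gt0 // ltr0n ?fact_gt0 // prodn_gt0 // => a; exact: fact_gt0.
move: (_ / (\prod_a _)%:R) w0 => w w0.
rewrite -lnM ?posrE ?divr_gt0 ?mulr_gt0 //; congr (_ * ln _).
by field; rewrite !gt_eqF.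
Qed.

(** * The cost of one draw *)

(** From ln u <= u - 1; when P and Q have the same total mass, the right-hand
    side is the chi-square divergence. *)
Lemma divergence_le_chi2 (R : realType) (T : finType) (P Q : T -> R) :
  (forall i, 0 <= P i) -> (forall i, 0 < P i -> 0 < Q i) ->
  divergence P Q <= \sum_i P i * (P i / Q i - 1).
Proof.
move=> P0 PQ; apply: ler_sum => i _.
have [->|Pi0] := eqVneq (P i) 0; first by rewrite !mul0r.
have Pi : 0 < P i by rewrite lt0r Pi0 P0.
have PQi : 0 < P i / Q i by rewrite divr_gt0 ?PQ.
rewrite ler_pM2l // -[X in ln X](subrK 1) addrC le_ln1Dx //; lra.
Qed.

(** The left-hand side is the mutual information of two successive draws.  With
    p' = (k - e_c) / (K - 1), the ratio p'_a / p_a exceeds 1 by 1 / (K - 1) for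
    a != c and falls short of 1 by (K - k_c) / ((K - 1) k_c) for a = c, so the
    chi-square divergence equals (K - k_c) / (k_c (K - 1)^2). *)
Lemma sum_divergence_remove_ball (R : realType) (C : nat) (k : 'I_C -> nat) :
  let K : R := (\sum_a k a)%:R in (1 < \sum_a k a)%N ->
  \sum_c (k c)%:R / K
    * divergence (fun a => (remove_ball k c a)%:R / (K - 1))
                 (fun a => (k a)%:R / K)
  <= (C%:R - 1) / (K - 1) ^+ 2.
Proof.
move=> K K1.
have K_gt1 : 1 < K by rewrite ltr1n.
have K_neq0 : K != 0 by rewrite gt_eqF //; lra.
have K1_neq0 : K - 1 != 0 by rewrite gt_eqF //; lra.
apply: (@le_trans _ _ (\sum_(c < C) (K - (k c)%:R) / (K * (K - 1) ^+ 2))).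
  apply: ler_sum => c _.
  have kcK : (k c)%:R <= K by rewrite ler_nat (bigD1 c) //= leq_addr.
  (* An empty color has weight 0, but keeps its nonnegative share of the
     bound, so that the final sum does not depend on how many are empty. *)
  have [->|kc] := posnP (k c).
    by rewrite !mul0r subr0 divr_ge0 ?mulr_ge0 ?sqr_ge0 //; lra.
  have kc0 : (k c)%:R != 0 :> R by rewrite pnatr_eq0 -lt0n.
  have -> : (K - (k c)%:R) / (K * (K - 1) ^+ 2) =
      (k c)%:R / K * ((K - (k c)%:R) / (k c)%:R / (K - 1) ^+ 2).
    by field; do !(apply/andP; split).
  apply: ler_wpM2l; first by rewrite divr_ge0 //; lra.
  apply: le_trans (divergence_le_chi2 _ _) _ => [a|a|].
  - by rewrite divr_ge0 //; lra.
  - have [ka0|ka] := posnP (k a).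
      by rewrite /remove_ball ka0 sub0n mul0r ltxx.
    by move=> _; apply: divr_gt0; [rewrite ltr0n | lra].
  have off a : a != c ->
      (remove_ball k c a)%:R / (K - 1) *
        ((remove_ball k c a)%:R / (K - 1) / ((k a)%:R / K) - 1) =
      (k a)%:R / (K - 1) ^+ 2.
    move=> /negbTE ac; rewrite /remove_ball ac subn0.
    have [->|ka] := posnP (k a); first by rewrite !mul0r.
    have ka0 : (k a)%:R != 0 :> R by rewrite pnatr_eq0 -lt0n.
    by field; do !(apply/andP; split).
  rewrite (bigD1 c) //= (eq_bigr _ off) -mulr_suml -natr_sum.
  have -> : (\sum_(a | a != c) k a)%:R = K - (k c)%:R :> R.
    by rewrite /K [in RHS](bigD1 c) //= natrD addrC addKr.
  rewrite /remove_ball eqxx (natrB _ kc).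
  rewrite le_eqVlt; apply/orP; left; apply/eqP.
  by field; do !(apply/andP; split).
rewrite -mulr_suml sumrB -[X in _ - X]natr_sum -/K.
rewrite (_ : \sum_(c < C) K = C%:R * K); last first.
  by rewrite mulr_natl sumr_const card_ord.
rewrite le_eqVlt; apply/orP; left; apply/eqP.
by field; do !(apply/andP; split).
Qed.

(** * The bound *)

Definition divergence_bound (R : realType) (N n : R) : R :=
  ln ((N - 1) / (N - n)) + 1 / (N - n + 1) - n / N.

(** The terms 1 / (N - n + 1) and ln (N - n) depend on N - n only and cancel.
    As ln ((N - 1) / (N - 2)) >= 1 / (N - 1), the difference of the two
    bounds is at least 1 / (N - 1) + n / (N - 1) - (n + 1) / N, which exceeds
    n / (N - 1)^2 by (N - 1 - n) / (N (N - 1)^2). *)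
Lemma divergence_bound_step (R : realType) (N n : R) :
  1 <= n -> n + 1 < N ->
  n / (N - 1) ^+ 2 + divergence_bound (N - 1) n <= divergence_bound N (n + 1).
Proof.
move=> n1 nN; rewrite /divergence_bound.
have -> : N - (n + 1) = N - 1 - n by lra.
have -> : ln ((N - 1) / (N - 1 - n)) =
    ln ((N - 1) / (N - 1 - 1)) + ln ((N - 1 - 1) / (N - 1 - n)).
  rewrite -lnM ?posrE; try by apply: divr_gt0; lra.
  congr ln; field; do !(apply/andP; split); rewrite gt_eqF //; lra.
have ln_ge : 1 / (N - 1) <= ln ((N - 1) / (N - 1 - 1)).
  have -> : (N - 1) / (N - 1 - 1) = (1 + - (1 / (N - 1)))^-1.
    by field; do !(apply/andP; split); rewrite ?gt_eqF //; lra.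
  have lt1 : 1 / (N - 1) < 1 by rewrite ltr_pdivrMr; lra.
  have := @le_ln1Dx R (- (1 / (N - 1))).
  rewrite ltrN2 lt1 lnV ?posrE ?subr_gt0 // => /(_ isT); lra.
suff : n / (N - 1) ^+ 2 <= 1 / (N - 1) + n / (N - 1) - (n + 1) / N by lra.
have -> : 1 / (N - 1) + n / (N - 1) - (n + 1) / N =
    n / (N - 1) ^+ 2 + (N - 1 - n) / (N * (N - 1) ^+ 2).
  by field; do !(apply/andP; split); rewrite gt_eqF //; lra.
by rewrite lerDl divr_ge0 ?mulr_ge0 ?sqr_ge0 //; lra.
Qed.

(** The induction starts at sample size 1, where the divergence and the bound
    are both 0; at size 0 the bound would be negative. *)
Lemma divergence_hypergeometric_le (R : realType) (C n : nat)
    (k : 'I_C -> nat) :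
  let K : R := (\sum_a k a)%:R in (n.+1 < \sum_a k a)%N ->
  divergence (hypergeometric_mass R (n := n.+1) k)
             (multinomial_mass (fun c => (k c)%:R / K))
  <= (C%:R - 1) * divergence_bound K n.+1%:R.
Proof.
elim: n k => [|n IH] k K nK; rewrite divergence_first_draw -/K.
  have K1 : 1 < K by rewrite ltr1n.
  rewrite big1 => [|c _].
    rewrite /divergence_bound subrK divff ?gt_eqF //; last by lra.
    by rewrite ln1 add0r subrr mulr0.
  rewrite /divergence sum_counts0 hypergeometric_mass0 multinomial_mass0.
  by rewrite divff ?oner_eq0 // ln1 !mulr0.
have n1K : n.+1%:R + 1 < K by rewrite natr1 ltr_nat.
have n1 : 1 <= n.+1%:R :> R by rewrite ler1n.
have C1 : 1 <= C%:R :> R.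
  rewrite ler1n; case: (C) k @K nK {n1K} => // k' K'.
  by rewrite big_ord0.
pose q c a : R := (remove_ball k c a)%:R / (K - 1).
pose p a : R := (k a)%:R / K.
apply: (@le_trans _ _ (\sum_c p c *
    ((C%:R - 1) * divergence_bound (K - 1) n.+1%:R
     + n.+1%:R * divergence (q c) p))).
  apply: ler_sum => c _.
  have [kc|kc] := posnP (k c); first by rewrite /p kc !mul0r.
  have sumk' : (\sum_a remove_ball k c a = (\sum_a k a).-1)%N.
    exact: sum_remove_ball.
  have K'E : (\sum_a remove_ball k c a)%:R = K - 1.
    by rewrite sumk' /K -[in RHS](prednK (ltn_trans _ nK)) // -natr1 addrK.
  have nK' : (n.+1 < \sum_a remove_ball k c a)%N.
    by rewrite sumk'; case: (\sum_a k a)%N nK.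
  apply: ler_wpM2l; first by rewrite divr_ge0 // ler0n.
  rewrite (@divergence_multinomial_change _ _ _ p (q c)).
  - by rewrite lerD2r /q -K'E; exact: IH.
  - move=> y /hypergeometric_mass_support[P0 ys yk]; split=> // a ya.
    have k'a := leq_trans ya (yk a).
    have ka := leq_trans k'a (leq_subr _ _).
    by split; apply: divr_gt0; (try lra); rewrite ltr0n.
  - by move=> a; rewrite hypergeometric_mean 1?ltnW // K'E.
under eq_bigr do rewrite mulrDr [X in _ + X]mulrCA.
rewrite big_split /= -mulr_suml -mulr_sumr sum_color_frequency; last first.
  exact: ltn_trans nK.
have KK : (1 < \sum_a k a)%N by exact: ltn_trans nK.
have := sum_divergence_remove_ball R KK; rewrite -/K -/p => chi2.
rewrite mul1r -[X in divergence_bound K X]natr1.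
apply: le_trans (lerD (lexx _) (ler_wpM2l (ler0n _ _) chi2)) _.
rewrite mulrCA -mulrDr ler_wpM2l ?subr_ge0 // [leLHS]addrC.
exact: divergence_bound_step.
Qed.

Theorem theorem4p6 (R : realType) (C N n : nat) (k : 'I_C -> nat)
    (k_ge1 : forall c, (1 <= k c)%N)
    (sum_k : (\sum_c k c)%N = N)
    (n_ge1 : (1 <= n)%N) (n_lt_N : (n < N)%N) :
  divergence (hypergeometric_mass R (n := n) k)
             (multinomial_mass (n := n) (fun c => (k c)%:R / N%:R : R))
  <= (C%:R - 1) * (ln ((N%:R - 1) / (N%:R - n%:R))
                   + 1 / (N%:R - n%:R + 1) - n%:R / N%:R).
Proof.
rewrite -sum_k in n_lt_N *; case: n n_ge1 n_lt_N => // n _ nN.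
exact: divergence_hypergeometric_le.
Qed.
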